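(* Every Krull domain $D$ is a $w_D$-Jaffard domain, i.e., $w_D\text{-}\dim(D)<\infty$ and $w_D\text{-}\dim(D)=w_D\text{-}\dim_v(D)$.
   Context: For a domain $D$ with quotient field $K$, $\overline{\mathcal F}(D)$ is the set of nonzero $D$-submodules of $K$ and $f(D)$ the set of nonzero finitely generated $D$-submodules of $K$. A semistar operation on $D$ is a map $\star:\overline{\mathcal F}(D)\to\overline{\mathcal F}(D)$, $E\mapsto E^\star$, such that for all $0\ne x\in K$ and $E,F\in\overline{\mathcal F}(D)$: $(xE)^\star=xE^\star$; $E\subseteq F$ implies $E^\star\subseteq F^\star$; $E\subseteq E^\star=(E^\star)^\star$. Define $E^{\star_f}:=\bigcup\{F^\star\mid F\in f(D),F\subseteq E\}$. A nonzero ideal $I$ of $D$ is a quasi-$\star$-ideal if $I^\star\cap D=I$; a quasi-$\star$-prime is a prime quasi-$\star$-ideal; $\operatorname{QMax}^{\star}(D)$ is the set of maximal elements of the set of proper quasi-$\star$-ideals (they are prime). $\widetilde\star$ is the semistar operation $E^{\widetilde\star}:=\bigcap\{ED_P\mid P\in\operatorname{QMax}^{\star_f}(D)\}$ (equal to $K$ if $\operatorname{QMax}^{\star_f}(D)=\emptyset$). $v_D$ is the operation $E^{v_D}:=(D:(D:E))$, where $(D:E)=\{x\in K\mid xE\subseteq D\}$ (with $E^{v_D}=K$ if $(D:E)=0$), and $w_D:=\widetilde{v_D}$. $\star\text{-}\dim(D)$ is the supremum of the integers $n$ such that there is a chain $(0)\subsetneq P_1\subsetneq\cdots\subsetneq P_n$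 with each $P_i$ a quasi-$\star$-prime of $D$; it is $0$ if there are no quasi-$\star$-primes. A valuation overring $V$ of $D$, i.e. a valuation domain with $D\subseteq V\subseteq K$ ($V=K$ allowed, of dimension $0$), is a $\star$-valuation overring if $F^\star\subseteq FV$ for each $F\in f(D)$. $\star\text{-}\dim_v(D)=n$ means every $\star$-valuation overring of $D$ has dimension at most $n$ and some $\star$-valuation overring has dimension $n$; if no such integer exists, $\star\text{-}\dim_v(D)=\infty$. *)

(* Defs.v *)
From mathcomp Require Import all_boot all_order all_algebra.
From mathcomp Require Import boolp classical_sets cardinality constructive_ereal.

Set Implicit Arguments.
Unset Strict Implicit.
Unset Printing Implicit Defensive.

Import Order.TTheory GRing.Theory Num.Theory.
Local Open Scope classical_set_scope.
Local Open Scope ring_scope.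

(* Throughout, a domain is a subring D of a field K, and its ideals, overrings,
   localizations and D-submodules of K are all subsets of K. *)

Definition is_subring (K : fieldType) (D : set K) : Prop :=
  [/\ D 1, forall x y, D x -> D y -> D (x - y)
         & forall x y, D x -> D y -> D (x * y)].

Definition is_quotient_field (K : fieldType) (D : set K) : Prop :=
  forall x : K, exists a b, [/\ D a, D b, b != 0 & x = a / b].

Section Modules.
Variables (K : fieldType) (D : set K).

Definition submodule (E : set K) : Prop :=
  [/\ E 0, forall x y, E x -> E y -> E (x + y)
         & forall d x, D d -> E x -> E (d * x)].

Definition Fbar (E : set K) : Prop := submodule E /\ E <> [set 0].

Definition span (n : nat) (g : 'I_n -> K) : set K :=
  [set x | exists d : 'I_n -> K,
     (forall i, D (d i)) /\ x = \sum_(i < n) d i * g i].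

Definition fgmod (F : set K) : Prop :=
  Fbar F /\ exists (n : nat) (g : 'I_n -> K), F = span g.

Definition ideal (I : set K) : Prop := submodule I /\ I `<=` D.

Definition prime_ideal (P : set K) : Prop :=
  [/\ ideal P, P <> D
    & forall x y, D x -> D y -> P (x * y) -> P x \/ P y].

Definition localization (P : set K) : set K :=
  [set x | exists a s, [/\ D a, D s, ~ P s & x = a / s]].

End Modules.

Definition setprod (K : fieldType) (E F : set K) : set K :=
  [set x | exists (n : nat) (e f : 'I_n -> K),
     [/\ forall i, E (e i), forall i, F (f i)
       & x = \sum_(i < n) e i * f i]].

(* The dimensions below take values in the natural numbers together with +oo,
   seen inside \bar int so as to have the order of extended numbers. *)
Definition dim_of_nat (n : nat) : \bar int := (n%:Z)%:E.

Definition krull_dim (K : fieldType) (V : set K) : \bar int :=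
  supremum 0%E [set dim_of_nat n | n in [set n | exists P : nat -> set K,
    (forall i, (i <= n)%N -> prime_ideal V (P i)) /\
    (forall i, (i < n)%N -> P i `<` P i.+1)]].

Section Semistar.
Variables (K : fieldType) (D : set K).

(* A semistar operation is a map star : set K -> set K, only evaluated on
   nonzero D-submodules of K. *)

Definition finite_type (star : set K -> set K) : set K -> set K :=
  fun E => \bigcup_(F in [set F | fgmod D F /\ F `<=` E]) star F.

Definition quasi_ideal (star : set K -> set K) (I : set K) : Prop :=
  [/\ ideal D I, I <> [set 0] & star I `&` D = I].

Definition quasi_prime (star : set K -> set K) (P : set K) : Prop :=
  quasi_ideal star P /\ prime_ideal D P.

Definition QMax (star : set K -> set K) : set (set K) :=
  [set I | [/\ quasi_ideal star I, I <> D
             & forall J, quasi_ideal star J -> J <> D -> I `<=` J -> J = I]].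

(* The intersection is K when QMax (finite_type star) is empty. *)
Definition tilde (star : set K -> set K) : set K -> set K :=
  fun E => \bigcap_(P in QMax (finite_type star))
    setprod E (localization D P).

Definition colon (E : set K) : set K := [set x | forall y, E y -> D (x * y)].

(* If colon E = 0 then v_op E is all of K. *)
Definition v_op : set K -> set K := fun E => colon (colon E).

Definition w_op : set K -> set K := tilde v_op.

Definition star_dim (star : set K -> set K) : \bar int :=
  supremum 0%E [set dim_of_nat n | n in [set n | exists P : nat -> set K,
    [/\ P 0%N = [set 0],
        forall i, (0 < i <= n)%N -> quasi_prime star (P i)
      & forall i, (i < n)%N -> P i `<` P i.+1]]].

Definition valuation_overring (V : set K) : Prop :=
  [/\ is_subring V, D `<=` V & forall x, x != 0 -> V x \/ V x^-1].

Definition star_valuation_overring (star : set K -> set K) (V : set K) : Prop :=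
  valuation_overring V /\ forall F, fgmod D F -> star F `<=` setprod F V.

Definition star_dimv (star : set K -> set K) : \bar int :=
  xget +oo%E [set dim_of_nat n | n in [set n |
    (forall V, star_valuation_overring star V ->
       (krull_dim V <= dim_of_nat n)%E) /\
    (exists2 V, star_valuation_overring star V &
       krull_dim V = dim_of_nat n)]].

Definition star_Jaffard (star : set K -> set K) : Prop :=
  (star_dim star < +oo)%E /\ star_dim star = star_dimv star.

End Semistar.

(* The value of v at 0, conventionally infinite, is irrelevant here. *)
Definition discrete_valuation (K : fieldType) (v : K -> int) : Prop :=
  [/\ forall x y, x != 0 -> y != 0 -> v (x * y) = v x + v y,
      forall x y, x != 0 -> y != 0 -> x + y != 0 ->
        Num.min (v x) (v y) <= v (x + y)
    & forall k : int, exists2 x, x != 0 & v x = k].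

Definition valuation_ring (K : fieldType) (v : K -> int) : set K :=
  [set x | x = 0 \/ 0 <= v x].

(* D is the intersection of the rings of a family of rank one discrete
   valuations of its quotient field, with finite character. The family may be
   empty, so fields are Krull domains. *)
Definition Krull_domain (K : fieldType) (D : set K) : Prop :=
  [/\ is_subring D, is_quotient_field D
    & exists (I : Type) (v : I -> K -> int),
      [/\ forall i, discrete_valuation (v i),
          D = \bigcap_(i in [set: I]) valuation_ring (v i)
        & forall x, x != 0 -> finite_set [set i | v i x != 0]]].

(* Main.v *)
Require Import Defs.
From mathcomp Require Import all_boot all_algebra classical_sets.
From mathcomp Require Import all_order boolp cardinality constructive_ereal.
From mathcomp Require Import zify ring.

Set Implicit Arguments.
Unset Strict Implicit.
Unset Printing Implicit Defensive.

Import Order.TTheory GRing.Theory Num.Theory.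
Local Open Scope classical_set_scope.
Local Open Scope ring_scope.

(** A Krull domain [D] is completely integrally closed and Mori, and only these
    two properties matter. The maximal [t]-ideals are the maximal conductors
    [P = (D :_D y)] of elements [y] outside [D]; they are prime. As [y] is not in
    [D], complete integral closure yields, for each nonzero [q] in [D], a power
    with [q y^n] in [D] but not in [P]; hence [D_P] is a discrete valuation ring
    with uniformizer [1/y], and [P] contains no smaller nonzero prime. So the
    quasi-[w]-primes are exactly these [P], and the [w]-valuation overrings other
    than [K] are the rings [D_P]: both dimensions are [1], or [0] if [D = K]. *)

(** * Elementary facts on discrete valuations *)

Section DiscreteValuation.
Variables (K : fieldType) (v : K -> int).
Implicit Types x y : K.

Lemma valuation_ringE x : x != 0 -> valuation_ring v x <-> 0 <= v x.
Proof. by move=> /eqP x0; split=> [[] //|]; right. Qed.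

Hypothesis dv : discrete_valuation v.

Lemma val1 : v 1 = 0.
Proof.
have [vM _ _] := dv; have := vM 1 1 (oner_neq0 _) (oner_neq0 _).
by rewrite mulr1; lia.
Qed.

Lemma valX x n : x != 0 -> v (x ^+ n) = v x *+ n.
Proof.
have [vM _ _] := dv => x0; elim: n => [|n IH]; first by rewrite expr0 val1.
by rewrite exprS mulrS vM ?expf_neq0 // IH.
Qed.

End DiscreteValuation.

(** * Complete integral closure and the Mori property of Krull domains *)

Definition completely_integrally_closed (K : fieldType) (D : set K) : Prop :=
  forall c x : K, c != 0 -> (forall n, D (c * x ^+ n)) -> D x.

(* In classical terms: every divisorial ideal is [F]^v for a finitely generated
   [F], which is a form of the ascending chain condition on such ideals. *)
Definition Mori (K : fieldType) (D : set K) : Prop :=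
  forall (J : set K) (a : K), J `<=` D -> J a -> a != 0 -> exists s : seq K,
    [/\ a \in s, forall f, f \in s -> J f
      & forall x, (forall f, f \in s -> D (x * f)) ->
          forall q, J q -> D (x * q)].

Lemma exists_min_int (T : Type) (J : set T) (w : T -> int) :
  J !=set0 -> (forall q, J q -> 0 <= w q) ->
  exists2 f, J f & forall q, J q -> w f <= w q.
Proof.
move=> [a Ja] w0.
have exP : exists n : nat, `[< exists2 q, J q & w q = n%:Z >].
  exists `|w a|%N; apply/asboolP; exists a => //.
  by have := w0 _ Ja; lia.
case: (ex_minnP exP) => n /asboolP[f Jf wf] n_min; exists f => // q Jq.
have wq := w0 _ Jq.
have : (n <= `|w q|)%N by apply/n_min/asboolP; exists q => //; lia.
by rewrite wf; lia.
Qed.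

Section KrullDomain.
Variables (K : fieldType) (D : set K).
Hypothesis krullD : Krull_domain D.

Lemma Krull_cic : completely_integrally_closed D.
Proof.
have [_ _ [I [v [dv -> _]]]] := krullD => c x c0 Dcx i _.
have [->|x0] := eqVneq x 0; first by left.
right; have [//|vx] := leP 0 (v i x).
(* If [v i x <= -1], this exponent already makes [v i (c * x ^+ n)] negative. *)
have := Dcx `|v i c|.+1 i Logic.I.
have [vM _ _] := dv i.
move/(valuation_ringE _ (mulf_neq0 c0 (expf_neq0 _ x0))).
by rewrite vM ?expf_neq0 // (valX (dv i)) // -mulr_natr; nia.
Qed.

(** Only finitely many valuations are nonzero at [a]. For each of them [s] contains an element of
    [J] of least value, which controls [v i x]; at all the others [v i a = 0], so that [a] itself
    forces [v i x >= 0]. *)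
Lemma Krull_Mori : Mori D.
Proof.
have [_ _ [I [v [dv DE fin]]]] := krullD => J a JD Ja a0.
(* Zero is removed because its value is arbitrary and would spoil the minimum. *)
pose J' := [set q | J q /\ q != 0].
have vD q i : D q -> q != 0 -> 0 <= v i q.
  by rewrite DE => /(_ i Logic.I)/valuation_ringE H /H.
have /choice[f fP] : forall i, exists f,
    J' f /\ forall q, J' q -> v i f <= v i q.
  move=> i; have [||f] := @exists_min_int _ J' (v i); first by exists a.
    by move=> q [Jq q0]; apply: vD => //; apply: JD.
  by exists f.
(* The index type is arbitrary; [{classic I}] equips it with the equality test that sequences
   need. *)
have /(@finite_seqP {classic I})[r rE] := fin a a0.
exists (a :: [seq f i | i <- r]); split; first exact: mem_head.
  move=> g; rewrite inE => /orP[/eqP -> //|/(@mapP {classic I})[i _ ->]].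
  by have [[]] := fP i.
move=> x xs q Jq.
have [x0|x0] := eqVneq x 0.
  by rewrite x0 mul0r -(mul0r a) -x0; apply: xs; exact: mem_head.
have [q0|q0] := eqVneq q 0.
  by rewrite q0 mulr0 DE => i _; left.
rewrite DE => i _; right.
have [vM _ _] := dv i; rewrite vM //.
have [va|va] := eqVneq (v i a) 0.
  have /vD : D (x * a) by apply: xs; exact: mem_head.
  move=> /(_ i (mulf_neq0 x0 a0)); rewrite vM // va addr0 => vx.
  by apply: addr_ge0 => //; apply: vD => //; apply: JD.
have [[Jf f0] f_min] := fP i.
have ir : i \in (r : seq {classic I}).
  by have : [set i | v i a != 0] i by []; rewrite rE.
have /vD : D (x * f i) by apply: xs; rewrite inE (@map_f {classic I} _ f) ?orbT.
move=> /(_ i (mulf_neq0 x0 f0)); rewrite vM //.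
by have := f_min q (conj Jq q0); lia.
Qed.
End KrullDomain.

(** * Dimensions as attained suprema, and generalities on subrings, spans and primes *)

Lemma supremum_dim (S : set nat) n : S n -> (forall m, S m -> (m <= n)%N) ->
  supremum 0%E [set dim_of_nat k | k in S] = dim_of_nat n.
Proof.
move=> Sn S_le; rewrite /supremum ifF; last first.
  by apply/negbTE/set0P; exists (dim_of_nat n); exists n.
have ubS : ubound [set dim_of_nat k | k in S] (dim_of_nat n).
  by move=> _ [k /S_le kn <-]; rewrite /dim_of_nat lee_fin lez_nat.
apply: xget_subset1; last exact: is_subset1_supremums.
by split=> // y; apply; exists n.
Qed.

Section Subring.
Variables (K : fieldType) (D : set K).
Hypothesis subD : is_subring D.
Implicit Types x y : K.

Lemma subring1 : D 1.
Proof. by case: subD. Qed.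

Lemma subringB x y : D x -> D y -> D (x - y).
Proof. by case: subD => _ + _; apply. Qed.

Lemma subringM x y : D x -> D y -> D (x * y).
Proof. by case: subD => _ _; apply. Qed.

Lemma subring0 : D 0.
Proof. by rewrite -(subrr 1); apply: subringB; exact: subring1. Qed.

Lemma subringD x y : D x -> D y -> D (x + y).
Proof.
move=> Dx Dy; rewrite -[y]opprK -[- y]sub0r.
by apply: subringB => //; apply: subringB => //; exact: subring0.
Qed.

Lemma subringX x n : D x -> D (x ^+ n).
Proof.
by move=> Dx; elim: n => [|n IH]; rewrite ?exprS; [exact: subring1|exact: subringM].
Qed.

Lemma submodule_span n (g : 'I_n -> K) : submodule D (Defs.span D g).
Proof.
split.
- exists (fun=> 0); split=> [i|]; first exact: subring0.
  by rewrite big1 // => i _; rewrite mul0r.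
- move=> _ _ [c [Dc ->]] [d [Dd ->]]; exists (fun i => c i + d i).
  split=> [i|]; first exact: subringD.
  by rewrite -big_split; apply: eq_bigr => i _; rewrite mulrDl.
- move=> d _ Dd [c [Dc ->]]; exists (fun i => d * c i).
  split=> [i|]; first exact: subringM.
  by rewrite mulr_sumr; apply: eq_bigr => i _; rewrite mulrA.
Qed.

Lemma span_gen n (g : 'I_n -> K) i : Defs.span D g (g i).
Proof.
exists (fun j => (j == i)%:R); split=> [j|].
  by case: (j == i); [exact: subring1|exact: subring0].
rewrite (bigD1 i) //= eqxx mul1r big1 ?addr0 // => j /negbTE ->.
by rewrite mul0r.
Qed.

Lemma span_sub n (g : 'I_n -> K) (E : set K) :
  submodule D E -> (forall i, E (g i)) -> Defs.span D g `<=` E.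
Proof.
move=> [E0 ED EM] Eg _ [c [Dc ->]].
by elim/big_ind: _ => // i _; exact: EM.
Qed.

Lemma fgmod_span n (g : 'I_n -> K) i : g i != 0 -> fgmod D (Defs.span D g).
Proof.
move=> /eqP gi0; split; last by exists n, g.
split; first exact: submodule_span.
by move=> E; apply: gi0; move: (span_gen g i); rewrite E.
Qed.

End Subring.

Lemma setprod_sub (K : fieldType) (E F N : set K) :
  N 0 -> (forall x y, N x -> N y -> N (x + y)) ->
  (forall e f, E e -> F f -> N (e * f)) -> setprod E F `<=` N.
Proof.
move=> N0 ND NM _ [n [e [f [Ee Ff ->]]]].
by elim/big_ind: _ => // i _; exact: NM.
Qed.

Lemma setprod_mul (K : fieldType) (E F : set K) e f :
  E e -> F f -> setprod E F (e * f).
Proof.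
by move=> Ee Ff; exists 1%N, (fun=> e), (fun=> f); split=> //; rewrite big_ord1.
Qed.

Lemma prime_ideal1 (K : fieldType) (D P : set K) :
  prime_ideal D P -> ~ P 1.
Proof.
move=> [[[_ _ PM] PD] PnD _] P1; apply: PnD; apply/seteqP; split=> // x Dx.
by rewrite -[x]mulr1; apply: PM.
Qed.

Lemma prime_ideal0 (K : fieldType) (D : set K) :
  is_subring D -> prime_ideal D [set 0].
Proof.
move=> subD; split.
- split=> [|x ->]; last exact: subring0.
  by split=> //= [x y -> ->|d x _ ->]; rewrite ?addr0 ?mulr0.
- by have := subring1 subD => + E; rewrite -E => /eqP; rewrite oner_eq0.
- move=> x y _ _ /= /eqP; rewrite mulf_eq0.
  by move=> /orP[] /eqP; [left|right].
Qed.

Lemma prime_ideal_neq0 (K : fieldType) (D P : set K) s :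
  prime_ideal D P -> ~ P s -> s != 0.
Proof.
by move=> [[[P0 _ _] _] _ _] Ps; apply/eqP => s0; apply: Ps; rewrite s0.
Qed.

Lemma prime_idealX (K : fieldType) (D P : set K) x n : is_subring D ->
  prime_ideal D P -> D x -> P (x ^+ n) -> P x.
Proof.
move=> subD primeP Dx; elim: n => [/(prime_ideal1 primeP) //|n IH].
have [_ _ PP] := primeP.
by rewrite exprS => /(PP _ _ Dx (subringX subD n Dx))[].
Qed.

Lemma nonzero_elt (K : fieldType) (E : set K) :
  E 0 -> E <> [set 0] -> exists2 x, E x & x != 0.
Proof.
move=> E0 En0; apply: contrapT => nex; apply: En0.
apply/seteqP; split=> x /=; last by move->.
by move=> Ex; apply: contrapT => /eqP x0; apply: nex; exists x.
Qed.

(** * Discrete valuation rings, given by a uniformizer *)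

Definition is_dvr (K : fieldType) (V : set K) (t : K) : Prop :=
  [/\ is_subring V, V t, ~ V t^-1 & forall x, x != 0 -> exists w n,
        [/\ V w, V w^-1 & x = w * t ^+ n \/ x = w * t ^- n]].

Section DVR.
Variables (K : fieldType) (V : set K) (t : K).
Hypothesis dvrV : is_dvr V t.

Let subV : is_subring V. Proof. by case: dvrV. Qed.
Let Vt : V t. Proof. by case: dvrV. Qed.
Let VtV : ~ V t^-1. Proof. by case: dvrV. Qed.

Lemma dvr_unif_neq0 : t != 0.
Proof.
(* By the convention [0^-1 = 0], the inverse of a zero [t] would lie in [V]. *)
apply/eqP => t0; apply: VtV; rewrite t0 invr0.
exact: subring0.
Qed.
Let t0 := dvr_unif_neq0.

Lemma dvr_val x : x != 0 -> V x \/ V x^-1.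
Proof.
have [_ _ _ H] := dvrV.
move=> /H[w [n [Vw Vw' [->|->]]]]; [left|right].
  exact/(subringM subV)/(subringX subV).
by rewrite invfM invrK; apply/(subringM subV)/(subringX subV).
Qed.

Lemma dvr_inv_notin n : ~ V (t ^- n.+1).
Proof.
move=> Vtn; apply: VtV.
suff -> : t^-1 = t ^- n.+1 * t ^+ n by exact/(subringM subV)/(subringX subV).
by rewrite exprS invfM mulfVK // expf_neq0.
Qed.

(** A negative exponent is excluded: [w^-1 * x] would be a negative power of [t] lying in [V]. *)
Lemma dvr_dec x : V x -> x != 0 ->
  exists w n, [/\ V w, V w^-1 & x = w * t ^+ n].
Proof.
have [_ _ _ H] := dvrV => Vx x0.
have [w [n [Vw Vw' [->|xE]]]] := H x x0; first by exists w, n.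
case: n xE => [|n] xE; first by exists w, 0%N; rewrite xE expr0 invr1.
have w0 : w != 0 by apply: contra_neq x0 => w0; rewrite xE w0 mul0r.
case: (@dvr_inv_notin n).
suff -> : t ^- n.+1 = w^-1 * x by exact: subringM.
by rewrite xE mulKf.
Qed.

(** The principal ideal [t V]. *)
Definition dvr_max : set K := [set x | V (x * t^-1)].

Lemma dvr_max_sub : dvr_max `<=` V.
Proof. by move=> x /(subringM subV)-/(_ _ Vt); rewrite mulfVK. Qed.

Lemma dvr_max_neq0 : dvr_max <> [set 0].
Proof.
have : dvr_max t by rewrite /dvr_max /= mulfV //; exact: subring1.
by move=> + E; rewrite E => /eqP; apply/negP.
Qed.

Lemma dvr_max_prime : prime_ideal V dvr_max.
Proof.
split.
- split; last exact: dvr_max_sub.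
  split; rewrite /dvr_max /=.
  + by rewrite mul0r; exact: subring0.
  + by move=> x y Vx Vy; rewrite mulrDl; exact: subringD.
  + by move=> d x Vd Vx; rewrite -mulrA; exact: subringM.
- have := subring1 subV => + E; rewrite -E /dvr_max /= mul1r; exact: VtV.
- move=> x y Vx Vy.
  have [->|x0] := eqVneq x 0.
    by move=> _; left; rewrite /dvr_max /= mul0r; exact: subring0.
  have [w [[|n] [Vw Vw' xE]]] := dvr_dec Vx x0; last first.
    move=> _; left; rewrite /dvr_max /= xE exprSr mulrA mulfK //.
    exact/(subringM subV)/(subringX subV).
  right; have w0 : w != 0 by move: x0; rewrite xE expr0 mulr1.
  suff -> : y = w^-1 * (x * y).
    by rewrite /dvr_max /= -mulrA; exact: subringM.
  by rewrite xE expr0 mulr1 mulKf.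
Qed.

(** A nonzero element [w * t ^+ n] of [Q] puts [t ^+ n], hence [t], in [Q]. Conversely no element of
    [Q] has exponent 0, as it would be a unit. *)
Lemma dvr_primeE Q : prime_ideal V Q -> Q <> [set 0] -> Q = dvr_max.
Proof.
move=> primeQ Qn0; have [[[Q0 QD QM] QV] _ QP] := primeQ.
have Qunit x w n : w != 0 -> V w^-1 -> Q (w * t ^+ n) -> Q (t ^+ n).
  by move=> w0 Vw' /(QM _ _ Vw'); rewrite mulKf.
have [x Qx x0] := nonzero_elt Q0 Qn0.
have Qt : Q t.
  have [w [n [Vw Vw' xE]]] := dvr_dec (QV _ Qx) x0.
  have w0 : w != 0 by apply: contra_neq x0 => w0; rewrite xE w0 mul0r.
  apply: (prime_idealX (n := n) subV primeQ Vt).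
  by rewrite -(mulKf w0 (t ^+ n)) -xE; exact: QM.
apply/seteqP; split=> z; last first.
  by rewrite /dvr_max /= => /QM /(_ Qt); rewrite mulfVK.
move=> Qz; have [->|z0] := eqVneq z 0.
  by rewrite /dvr_max /= mul0r; exact: subring0.
have [w [[|n] [Vw Vw' zE]]] := dvr_dec (QV _ Qz) z0.
  case: (prime_ideal1 primeQ).
  have w0 : w != 0 by move: z0; rewrite zE expr0 mulr1.
  by rewrite -(mulVf w0); apply: QM => //; move: Qz; rewrite zE expr0 mulr1.
rewrite /dvr_max /= zE exprSr mulrA mulfK //.
exact/(subringM subV)/(subringX subV).
Qed.

Lemma krull_dim_dvr : krull_dim V = dim_of_nat 1%N.
Proof.
apply: supremum_dim.
  exists (fun i => if i == 0%N then [set 0] else dvr_max); split.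
    case=> [|i] _ /=; last exact: dvr_max_prime.
    exact: prime_ideal0.
  case=> // _; split=> [x ->|] /=.
    by rewrite /dvr_max /= mul0r; exact: subring0.
  move=> H; apply: dvr_max_neq0; apply/seteqP; split=> // x ->.
  by rewrite /dvr_max /= mul0r; exact: subring0.
(* In a chain of length at least 2, [P 1] and [P 2] are nonzero, so both equal [dvr_max]. *)
case=> [|[|m]] // [P [primeP ltP]].
have Pn0 i : (i <= m.+1)%N -> P i.+1 <> [set 0].
  move=> im E; have [_ []] := ltP i im; rewrite E => x ->.
  by have [[[? _ _] _] _ _] := primeP i (leqW im).
have [_ []] := ltP 1%N isT.
rewrite (dvr_primeE (primeP 2 isT) (Pn0 1%N isT)).
by rewrite (dvr_primeE (primeP 1%N isT) (Pn0 0%N isT)).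
Qed.

(** An element outside [V] is a unit times [t ^- n.+1]; multiplied by the inverse unit and [t ^+ n]
    it becomes [t^-1], which together with [V] generates [K]. *)
Lemma dvr_overring W : is_subring W -> V `<=` W -> W = setT \/ W = V.
Proof.
move=> subW VW; have [Wt|nWt] := pselect (W t^-1); [left|right].
  apply/seteqP; split=> // x _.
  have [->|x0] := eqVneq x 0; first exact: subring0.
  have [_ _ _ /(_ x x0)[w [n [/VW Ww _ [->|->]]]]] := dvrV.
    by apply/(subringM subW)/(subringX subW) => //; exact: VW.
  by rewrite -exprVn; exact/(subringM subW)/(subringX subW).
apply/seteqP; split=> // x Wx.
have [->|x0] := eqVneq x 0; first exact: subring0.
have [_ _ _ /(_ x x0)[w [n [Vw /VW Ww [->|xE]]]]] := dvrV.
  exact/(subringM subV)/(subringX subV).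
case: n xE => [|n] xE; first by rewrite xE expr0 invr1 mulr1.
case: nWt; have w0 : w != 0 by apply: contra_neq x0 => w0; rewrite xE w0 mul0r.
have -> : t^-1 = w^-1 * x * t ^+ n.
  by rewrite xE mulKf // exprS invfM mulfVK // expf_neq0.
apply: (subringM subW); first exact: subringM.
by apply: (subringX subW); exact: VW.
Qed.
End DVR.

Lemma prime_ideal_setT (K : fieldType) (P : set K) :
  prime_ideal setT P -> P = [set 0].
Proof.
move=> primeP; have [[[P0 _ PM] _] _ _] := primeP.
apply: contrapT => /(nonzero_elt P0)[x Px x0].
by apply: (prime_ideal1 primeP); rewrite -(mulVf x0); exact: PM.
Qed.

Lemma krull_dim_setT (K : fieldType) : krull_dim [set: K] = dim_of_nat 0%N.
Proof.
apply: supremum_dim.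
  exists (fun=> [set 0]); split=> // i _; exact: prime_ideal0.
case=> [|m] // [P [primeP ltP]]; have [_ []] := ltP 0%N isT.
by rewrite (prime_ideal_setT (primeP 0%N isT)) (prime_ideal_setT (primeP 1%N isT)).
Qed.

(** * Conductors and maximal [t]-ideals *)

Section CompletelyIntegrallyClosedMori.
Variables (K : fieldType) (D : set K).
Hypotheses (subD : is_subring D) (fracD : is_quotient_field D).
Hypotheses (cicD : completely_integrally_closed D) (MoriD : Mori D).
Implicit Types (x y q : K) (J Q P : set K).

(** The conductor [(D :_D y)]. *)
Definition denom y : set K := [set d | D d /\ D (d * y)].

Definition max_denom y : Prop :=
  ~ D y /\ forall z, ~ D z -> denom y `<=` denom z -> denom z = denom y.

Lemma denom_ideal y : ideal D (denom y).
Proof.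
split; last by move=> x [].
split.
- by split; rewrite ?mul0r; exact: subring0.
- by move=> x z [Dx Dxy] [Dz Dzy]; split; rewrite ?mulrDl; exact: subringD.
- by move=> d x Dd [Dx Dxy]; split; rewrite -?mulrA; exact: subringM.
Qed.

Lemma denom_neq0 y : exists2 b, denom y b & b != 0.
Proof.
have [a [b [Da Db b0 ->]]] := fracD y.
by exists b => //; split=> //; rewrite mulrC divfK.
Qed.

Lemma denom_proper y : ~ D y -> denom y <> D.
Proof.
move=> nDy E; apply: nDy; have [_] : denom y 1 by rewrite E; exact: subring1.
by rewrite mul1r.
Qed.

(** Zorn's lemma: the union of a chain of conductors has the same inverse as a finite part [s] of
    it. One member [denom y] of the chain contains [s], so [y] multiplies the whole union into [D],
    and the union is [denom y]. *)
Lemma exists_max_denom x : ~ D x -> exists y, max_denom y.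
Proof.
move=> nDx.
(* The empty set is added as the union of the empty chain; it is not maximal, since [denom x] is
   larger. *)
pose S := [set X : set K | X = set0 \/ exists2 y, ~ D y & X = denom y].
have [|A [SA A_max]] := @Zorn_bigcup _ S.
  move=> F FS F_tot; set U := \bigcup_(X in F) X.
  have [[X0 FX0 X0n]|Fe] := pselect (exists2 X, F X & X <> set0); last first.
    left; apply/seteqP; split=> // z [X FX Xz].
    by apply: Fe; exists X => // E; rewrite E in Xz.
  have [//|[y0 nDy0 X0E]] := FS _ FX0.
  have [a [aP a0]] : exists a, X0 a /\ a != 0.
    by have [b ? ?] := denom_neq0 y0; exists b; rewrite X0E.
  have UD : U `<=` D.
    by move=> z [X /FS[-> //|[y _ ->]] []].
  have [|s [as' sU s_gen]] := MoriD UD _ a0; first by exists X0.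
  have [X FX sX] : exists2 X, F X & forall f, f \in s -> X f.
    elim: s sU {as' s_gen} => [_|f s IH sU]; first by exists X0.
    have [X FX sX] := IH (fun g gs => sU g (mem_behead (s := f :: s) gs)).
    have [Y FY Yf] := sU f (mem_head _ _).
    have [XY|YX] := F_tot _ _ FX FY.
      by exists Y => // g; rewrite inE => /orP[/eqP -> //|/sX /XY].
    by exists X => // g; rewrite inE => /orP[/eqP ->|/sX //]; exact: YX.
  have [XE|[y nDy XE]] := FS _ FX; first by have := sX _ as'; rewrite XE.
  right; exists y => //; apply/seteqP; split=> z; last first.
    by rewrite -XE => Xz; exists X.
  move=> Uz; split; first exact: UD.
  by rewrite mulrC; apply: s_gen Uz => f /sX; rewrite XE mulrC => -[].
have [A0|[y nDy AE]] := SA.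
  have [b [Db Dbx] _] := denom_neq0 x.
  case: (A_max (denom x)); last by right; exists x.
  rewrite A0; split=> // /(_ b); apply; by split.
exists y; split=> // z nDz yz; apply: contrapT => ne.
apply: (A_max (denom z)); last by right; exists z.
by rewrite AE; split=> // zy; apply: ne; apply/seteqP.
Qed.

(** If [F] lies in [denom y], then [y] lies in [(D : F)] and so multiplies [F^v] into [D]. *)
Lemma denom_tideal y : ~ D y -> quasi_ideal D (finite_type D (v_op D)) (denom y).
Proof.
move=> nDy; split; first exact: denom_ideal.
  by move=> E; have [b + b0] := denom_neq0 y; rewrite E => /eqP; apply/negP.
apply/seteqP; split=> x.
  move=> [[F [fgF Fy] vFx] Dx]; split=> //.
  by apply: vFx => z /Fy[_]; rewrite mulrC.
move=> yx; split; last by case: yx.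
have [b yb b0] := denom_neq0 y.
(* The generator [b] keeps the span nonzero even when [x = 0]. *)
pose g (i : 'I_2) := if i == 0 then b else x.
have gy i : denom y (g i) by rewrite /g; case: ifP.
have [sub_y _] := denom_ideal y.
exists (Defs.span D g).
  split; first exact: (@fgmod_span _ _ subD _ g 0).
  exact: span_sub.
move=> z; apply: (_ : colon D (Defs.span D g) z -> _).
by rewrite mulrC; apply; exact: (span_gen subD g 1).
Qed.

(* A proper [t]-ideal contains no finitely generated [F] with [F^v = D], and
   the Mori property provides one with the same inverse as the ideal. *)
Lemma tideal_sub_denom J : quasi_ideal D (finite_type D (v_op D)) J -> J <> D ->
  exists2 y, ~ D y & J `<=` denom y.
Proof.
move=> [[[J0 JDD JM] JD] Jn0 JE] JnD.
have [a Ja a0] := nonzero_elt J0 Jn0.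
have [s [as' sJ s_gen]] := MoriD JD Ja a0.
pose g (i : 'I_(size s)) := s`_i.
have gJ i : J (g i) by apply/sJ/mem_nth.
have ia : (index a s < size s)%N by rewrite index_mem.
have fg : fgmod D (Defs.span D g).
  by apply: (@fgmod_span _ _ subD _ g (Ordinal ia)); rewrite /g /= nth_index.
have nv1 : ~ v_op D (Defs.span D g) 1.
  move=> v1; apply: JnD; apply/seteqP; split=> // x Dx.
  rewrite -[x]mulr1; apply: (JM) => //; rewrite -JE; split; last exact: subring1.
  by exists (Defs.span D g) => //; split=> //; exact: (span_sub (And3 J0 JDD JM) gJ).
(* If [(D : F)] were contained in [D], then [1] would lie in [F^v]. *)
have [y [gy nDy]] : exists y, colon D (Defs.span D g) y /\ ~ D y.
  apply: contrapT => nex; apply: nv1 => y gy; rewrite mul1r.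
  by apply: contrapT => nDy; apply: nex; exists y.
exists y => // q Jq; split; first exact: JD.
rewrite mulrC; apply: s_gen Jq => f fs; apply: gy.
have fi : (index f s < size s)%N by rewrite index_mem.
by have := span_gen subD g (Ordinal fi); rewrite /g /= nth_index.
Qed.

(** Conductors of elements outside [D] are proper [t]-ideals, and every proper [t]-ideal lies in one
    of them; hence the maximal elements agree. *)
Lemma QMaxE P : QMax D (finite_type D (v_op D)) P <->
  exists2 y, max_denom y & P = denom y.
Proof.
split=> [[tP PnD P_max]|[y [nDy y_max] ->]].
  have [y nDy Py] := tideal_sub_denom tP PnD.
  have PE := P_max _ (denom_tideal nDy) (denom_proper nDy) Py.
  exists y => //; split=> // z nDz; rewrite PE => Pz.
  exact: P_max _ (denom_tideal nDz) (denom_proper nDz) Pz.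
split; [exact: denom_tideal|exact: denom_proper|].
move=> J tJ JnD yJ; have [z nDz Jz] := tideal_sub_denom tJ JnD.
have zE := y_max z nDz (subset_trans yJ Jz).
by apply/seteqP; split=> //; rewrite -zE.
Qed.

(** * Localization at a maximal conductor *)

Section MaximalDenominator.
Variable y : K.
Hypothesis ymax : max_denom y.

Let P := denom y.
Let nDy : ~ D y. Proof. by case: ymax. Qed.

(** For [a] in [D] outside [P], the element [a * y] is not in [D] and its conductor contains [P], so
    it equals [P] by maximality; this conductor contains [b]. *)
Lemma max_denom_prime : prime_ideal D P.
Proof.
split; [exact: denom_ideal|exact: denom_proper|].
move=> a b Da Db [_ Daby].
have [Day|nDay] := pselect (D (a * y)); [by left|right].
have <- : denom (a * y) = P.
  case: ymax => _; apply=> // x [Dx Dxy]; split=> //.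
  by rewrite mulrCA; exact: subringM.
by split=> //; rewrite mulrCA mulrA.
Qed.

(** Otherwise each [q * y ^+ n] is in [P], so the next one is again in [D]; complete integral
    closure then puts [y] in [D]. The exponent found is the value of [q] at [P]. *)
Lemma max_denom_escape q : D q -> q != 0 ->
  exists2 n, D (q * y ^+ n) & ~ P (q * y ^+ n).
Proof.
move=> Dq q0; apply: contrapT => nex; apply: nDy; apply: (cicD q0) => n.
elim: n => [|n IH]; first by rewrite expr0 mulr1.
have [[_]|nP] := pselect (P (q * y ^+ n)); first by rewrite exprSr mulrA.
by case: nex; exists n.
Qed.

(** If [P] were stable under multiplication by [y], no nonzero [b] in [P] could escape. Such a [p]
    is associate to [1/y] in the localization. *)
Lemma max_denom_unif : exists2 p, P p & ~ P (p * y).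
Proof.
apply: contrapT => nex; have [b Pb b0] := denom_neq0 y.
have [Db _] := Pb.
have [n _ []] := max_denom_escape Db b0.
elim: n => [|n IH]; first by rewrite expr0 mulr1.
rewrite exprSr mulrA; apply: contrapT => nP; apply: nex.
by exists (b * y ^+ n).
Qed.

Let y0 : y != 0.
Proof. by apply/eqP => y0; apply: nDy; rewrite y0; exact: subring0. Qed.

Let V := localization D P.

Lemma localization_sub : D `<=` V.
Proof.
move=> x Dx; exists x, 1; split=> //; [exact: subring1| |by rewrite divr1].
exact: prime_ideal1 max_denom_prime.
Qed.

Let unitV s : D s -> ~ P s -> V s^-1.
Proof. by move=> Ds Ps; exists 1, s; split=> //; [exact: subring1|rewrite mul1r]. Qed.

Let neq0 s : ~ P s -> s != 0.
Proof. exact: prime_ideal_neq0 max_denom_prime. Qed.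

Lemma localization_subring : is_subring V.
Proof.
have [_ _ PP] := max_denom_prime.
have nPM s s' : D s -> D s' -> ~ P s -> ~ P s' -> ~ P (s * s').
  by move=> Ds Ds' Ps Ps' /(PP _ _ Ds Ds')[].
split; first by apply: localization_sub; exact: subring1.
- move=> _ _ [a [s [Da Ds Ps ->]]] [b [r [Db Dr Pr ->]]].
  exists (a * r - b * s), (s * r); split.
  + by apply: subringB => //; exact: subringM.
  + exact: subringM.
  + exact: nPM.
  + by have := neq0 Ps; have := neq0 Pr => ? ?; field; apply/andP.
- move=> _ _ [a [s [Da Ds Ps ->]]] [b [r [Db Dr Pr ->]]].
  exists (a * b), (s * r); split; [exact: subringM|exact: subringM|exact: nPM|].
  by rewrite invfM mulrACA.
Qed.

(** For [x = a / b] with escape exponents [n] and [m], both [a * y ^+ n] and [b * y ^+ m] are units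
    of [V], so [x] is a unit times the power [n - m] of [1/y]. *)
Lemma localization_dvr : is_dvr V y^-1.
Proof.
have [p Pp nPpy] := max_denom_unif; have [Dp Dpy] := Pp.
split; first exact: localization_subring.
- have -> : y^-1 = p * (p * y)^-1.
    by have := neq0 nPpy; rewrite mulf_eq0 negb_or => /andP[? ?]; field; apply/andP.
  by apply: (subringM localization_subring); [exact: localization_sub|exact: unitV].
(* Writing [y = a / s] gives [s * y = a] in [D], which places [s] in [P]. *)
- rewrite invrK => -[a [s [Da Ds Ps yE]]]; apply: (Ps); split=> //.
  by rewrite {1}yE mulrCA mulfV ?mulr1 //; exact: neq0 Ps.
- move=> x x0; have [a [b [Da Db b0 xE]]] := fracD x.
  have a0 : a != 0 by apply: contra_neq x0 => a0; rewrite xE a0 mul0r.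
  have [n Dn Pn] := max_denom_escape Da a0.
  have [m Dm Pm] := max_denom_escape Db b0.
  have VM := subringM localization_subring.
  exists (a * y ^+ n / (b * y ^+ m)).
  exists (if (m <= n)%N then n - m else m - n)%N; split.
  + by apply: VM; [exact: localization_sub|exact: unitV].
  + by rewrite invf_div; apply: VM; [exact: localization_sub|exact: unitV].
  + have yX k : y ^+ k != 0 by rewrite expf_neq0.
    case: leqP => mn; [left|right]; rewrite xE exprVn ?invrK.
      rewrite -{1}(subnK mn) exprD; move: (yX (n - m)%N) (yX m) => ? ?.
      by field; do ?[apply/andP; split].
    rewrite -{1}(subnK (ltnW mn)) exprD; move: (yX (m - n)%N) (yX n) => ? ?.
    by field; do ?[apply/andP; split].
Qed.

(** For [q] in [Q] escaping with exponent [n], the product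
    [p ^+ n * (q * y ^+ n) = q * (p * y) ^+ n] is in [Q], which forces [p] into [Q]. Then
    [x * (p * y) = p * (x * y)] forces every [x] of [P] into [Q]. *)
Lemma prime_sub_max_denom Q : prime_ideal D Q -> Q <> [set 0] ->
  Q `<=` P -> Q = P.
Proof.
move=> primeQ Qn0 QP; have [[[Q0 QD QM] QsD] _ Qprime] := primeQ.
have [q Qq q0] := nonzero_elt Q0 Qn0.
have [p Pp nPpy] := max_denom_unif; have [Dp Dpy] := Pp.
have Qp : Q p.
  have [n Dn Pn] := max_denom_escape (QsD _ Qq) q0.
  apply: (prime_idealX (n := n) subD primeQ Dp).
  have : Q (p ^+ n * (q * y ^+ n)).
    rewrite mulrCA -exprMn mulrC; apply: QM => //; exact: subringX.
  by move=> /(Qprime _ _ (subringX subD n Dp) Dn)[//|/QP].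
apply/seteqP; split=> // x [Dx Dxy].
have : Q (x * (p * y)) by rewrite mulrCA mulrC; apply: QM.
by move=> /(Qprime _ _ Dx Dpy)[//|/QP].
Qed.

Lemma localization_valuation_overring : valuation_overring D V.
Proof.
split; [exact: localization_subring|exact: localization_sub|].
by move=> x; exact: (dvr_val localization_dvr).
Qed.

End MaximalDenominator.

(** * The [w]-operation, its quasi-primes and its valuation overrings *)

Lemma w_opE (E : set K) x : w_op D E x <->
  forall y, max_denom y -> setprod E (localization D (denom y)) x.
Proof.
split=> [wx y ymax|H P /QMaxE[y ymax ->]]; last exact: H.
by apply: wx; apply/QMaxE; exists y.
Qed.

(** An element of [E] outside [denom y] is a unit of the localization there; if this happens for
    every maximal conductor, [1] is in the [w]-closure. *)
Lemma w_op1N (E : set K) : E `<=` D -> ~ w_op D E 1 ->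
  exists2 y, max_denom y & E `<=` denom y.
Proof.
move=> ED nw1; apply: contrapT => nex; apply: nw1; apply/w_opE => y ymax.
have [e Ee nye] : exists2 e, E e & ~ denom y e.
  apply: contrapT => nex'; apply: nex; exists y => // e Ee.
  by apply: contrapT => nye; apply: nex'; exists e.
have e0 : e != 0 := prime_ideal_neq0 (max_denom_prime ymax) nye.
rewrite -(mulfV e0); apply: setprod_mul => //.
by exists 1, e; split=> //; [exact: subring1|exact: ED|rewrite mul1r].
Qed.

Lemma quasi_primeE Q : quasi_prime D (w_op D) Q <->
  exists2 y, max_denom y & Q = denom y.
Proof.
split=> [[[[_ QD] Qn0 QE] primeQ]|[y ymax ->]].
  have [|y ymax Qy] := w_op1N QD.
    move=> w1; apply: (prime_ideal1 primeQ); rewrite -QE; split=> //.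
    exact: subring1.
  by exists y => //; exact: prime_sub_max_denom.
have primeP := max_denom_prime ymax.
have [nDy _] := ymax; have [? ? _] := denom_tideal nDy.
split=> //; split=> //; apply/seteqP; split=> x.
  move=> [/w_opE/(_ _ ymax) wx Dx].
  pose V := localization D (denom y).
  have subV : is_subring V := localization_subring ymax.
  (* Multiplication by [y] sends [P] into [D], hence [P V] into [V]. Clearing the denominator [s] of
     [x * y] puts [x * s] in [P]. *)
  have : V (x * y).
    apply: (@setprod_sub _ _ _ [set x | V (x * y)] _ _ _ x wx) => /=.
    - by rewrite mul0r; exact: subring0.
    - by move=> a b Va Vb; rewrite mulrDl; exact: subringD.
    - move=> e f [_ Dey] Vf; rewrite mulrAC; apply: subringM => //.
      exact: localization_sub.
  move=> [a [s [Da Ds Ps xyE]]].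
  have [_ _ PP] := primeP.
  have s0 : s != 0 := prime_ideal_neq0 primeP Ps.
  have Pxs : denom y (x * s).
    by split; [exact: subringM|rewrite mulrAC xyE divfK].
  by case: (PP _ _ Dx Ds Pxs).
move=> yx; split; last by case: yx.
apply/w_opE => z zmax; rewrite -[x]mulr1; apply: setprod_mul => //.
by apply: localization_sub => //; exact: subring1.
Qed.

(** A second step in a chain would give two distinct nonzero primes, one inside the other, the
    larger a maximal conductor. *)
Lemma star_dim_w y : max_denom y -> star_dim D (w_op D) = dim_of_nat 1%N.
Proof.
move=> ymax; apply: supremum_dim.
  exists (fun i => if i == 0%N then [set 0] else denom y); split=> //.
    by case=> // i _; apply/quasi_primeE; exists y.
  have [[[? _ _] _] _ _] := max_denom_prime ymax.
  case=> // _; split=> [x -> //|] H.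
  by have [b /H /= -> /eqP] := denom_neq0 y.
case=> [|[|m]] // [P [_ PQ ltP]].
have /quasi_primeE[y1 _ P1] := PQ 1%N isT.
have /quasi_primeE[y2 max2 P2] := PQ 2 isT.
have [sub12 []] := ltP 1%N isT.
have [[_ n0 _] prime1] := PQ 1%N isT.
by rewrite P2 in sub12 *; rewrite (prime_sub_max_denom max2 prime1 n0 sub12).
Qed.

(** Let [F] be finitely generated in the center [Q] of [V], with the same inverse as [Q]. Since
    [F^w] lies in [F V], it misses [1], so [F] and then [Q] lie in a maximal conductor. Thus [V]
    contains the discrete valuation ring there, and equals it unless it is [K]. *)
Lemma star_valuation_overringE V : star_valuation_overring D (w_op D) V ->
  V = setT \/ exists2 y, max_denom y & V = localization D (denom y).
Proof.
move=> [[subV DV valV] starV].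
have [VT|VnT] := pselect (V = setT); [by left|right].
(* The center of [V] on [D]; zero is listed apart because [0^-1 = 0] lies in [V]. *)
pose Q := [set x | D x /\ (x = 0 \/ ~ V x^-1)].
have QD : Q `<=` D by move=> x [].
have [a Qa a0] : exists2 a, Q a & a != 0.
  have [x nVx] : exists x, ~ V x.
    apply: contrapT => nex; apply: VnT; apply/seteqP; split=> // x _.
    by apply: contrapT => nVx; apply: nex; exists x.
  have x0 : x != 0 by apply/eqP => x0; apply: nVx; rewrite x0; exact: subring0.
  have [c [b [Dc Db b0 xE]]] := fracD x.
  (* The denominator of an element outside [V] cannot be a unit of [V]. *)
  exists b => //; split=> //; right=> Vb; apply: nVx; rewrite xE.
  by apply: subringM => //; exact: DV.
have [s [as' sQ s_gen]] := MoriD QD Qa a0.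
pose g (i : 'I_(size s)) := s`_i.
have ia : (index a s < size s)%N by rewrite index_mem.
have fg : fgmod D (Defs.span D g).
  by apply: (@fgmod_span _ _ subD _ g (Ordinal ia)); rewrite /g /= nth_index.
(* The maximal ideal of [V]. *)
pose M := [set x | V x /\ (x = 0 \/ ~ V x^-1)].
have MM x v : M x -> V v -> M (x * v).
  move=> [Vx xM] Vv; split; first exact: subringM.
  have [->|v0] := eqVneq v 0; first by rewrite mulr0; left.
  case: xM => [->|nVx]; first by rewrite mul0r; left.
  right=> Vxv; apply: nVx; have -> : x^-1 = v * (x * v)^-1.
    by rewrite invfM mulrCA mulfV ?mulr1.
  exact: subringM.
have MD x z : M x -> M z -> M (x + z).
  move=> Mx Mz; have [->|x0] := eqVneq x 0; first by rewrite add0r.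
  have [->|z0] := eqVneq z 0; first by rewrite addr0.
  (* One of [x], [z] divides the other in [V], so the sum is a multiple of one of them. *)
  have [Vxz|Vzx] := valV (x / z) (mulf_neq0 x0 (invr_neq0 z0)).
    have -> : x + z = z * (x / z + 1) by rewrite mulrDr mulr1 mulrCA mulfV ?mulr1.
    by apply: MM => //; apply: subringD => //; exact: subring1.
  have -> : x + z = x * (1 + (x / z)^-1).
    by rewrite invf_div mulrDr mulr1 mulrCA mulfV ?mulr1.
  by apply: MM => //; apply: subringD => //; exact: subring1.
have M0 : M 0 by split; [exact: subring0|left].
have subM : submodule D M.
  by split=> // d x /DV Vd Mx; rewrite mulrC; exact: MM.
have gM : Defs.span D g `<=` M.
  by apply: span_sub => // i; have [/DV] := sQ _ (mem_nth 0 (ltn_ord i)).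
have gD : Defs.span D g `<=` D.
  apply: span_sub => [|i]; last by have [] := sQ _ (mem_nth 0 (ltn_ord i)).
  by split; [exact: subring0|move=> *; exact: subringD|move=> *; exact: subringM].
have [|y ymax gy] := w_op1N gD.
  move=> /(starV _ fg) /(setprod_sub M0 MD (fun e f => MM e f \o gM e))[_ []].
    by move=> /eqP; rewrite oner_eq0.
  by rewrite invr1 => /(_ (subring1 subV)).
exists y => //.
have QP : Q `<=` denom y.
  move=> q Qq; split; first exact: QD.
  rewrite mulrC; apply: s_gen Qq => f fs; rewrite mulrC.
  have fi : (index f s < size s)%N by rewrite index_mem.
  by have := span_gen subD g (Ordinal fi); rewrite /g /= nth_index // => /gy[].
have PV : localization D (denom y) `<=` V.
  move=> _ [c [r [Dc Dr Pr ->]]]; apply: subringM => //; first exact: DV.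
  by apply: contrapT => nVr; apply: Pr; apply: QP; split=> //; right.
by have [|] := dvr_overring (localization_dvr ymax) subV PV.
Qed.

Lemma localization_star_valuation_overring y : max_denom y ->
  star_valuation_overring D (w_op D) (localization D (denom y)).
Proof.
move=> ymax; split; first exact: localization_valuation_overring.
by move=> F _ x /w_opE; apply.
Qed.
End CompletelyIntegrallyClosedMori.

(** * Comparison of the two dimensions *)

Lemma star_dimv_eq (K : fieldType) (D : set K) star n :
  (forall V, star_valuation_overring D star V ->
     (krull_dim V <= dim_of_nat n)%E) ->
  (exists2 V, star_valuation_overring D star V & krull_dim V = dim_of_nat n) ->
  star_dimv D star = dim_of_nat n.
Proof.
move=> leV [V sV VE]; apply: xget_unique.
  by exists n => //; split=> //; exists V.
(* Two admissible integers bound each other, which is the uniqueness required to evaluate [xget]. *)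
move=> _ [m [leVm [W sW WE]] <-].
by apply: le_anti; rewrite -{1}WE leV //= -VE leVm.
Qed.

Theorem mainTheorem12 (K : fieldType) (D : set K) :
  Krull_domain D -> star_Jaffard D (w_op D).
Proof.
move=> krullD; have [subD fracD _] := krullD.
have cicD := Krull_cic krullD; have MoriD := Krull_Mori krullD.
have [DT|[x nDx]] : D = setT \/ exists x, ~ D x.
  have [?|nex] := pselect (exists x, ~ D x); [by right|left].
  apply/seteqP; split=> // x _; apply: contrapT => nDx.
  by apply: nex; exists x.
(* For [D = K] there is no nonzero prime and the only overring is [K], so both dimensions are 0. *)
- subst D.
  have dim0 : star_dim setT (w_op [set: K]) = dim_of_nat 0%N.
    apply: supremum_dim; first by exists (fun=> [set 0]); split=> // -[].
    case=> [|m] // [P [_ PQ _]].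
    by have [[_ n0 _] /prime_ideal_setT] := PQ 1%N isT.
  split; rewrite dim0 ?ltry //; apply/esym/star_dimv_eq.
    move=> V [[_ DV _] _]; have -> : V = setT by apply/seteqP.
    by rewrite krull_dim_setT.
  exists setT; last exact: krull_dim_setT.
  split; first by split=> // *; left.
  move=> F [[[F0 _ _] /(nonzero_elt F0)[f Ff f0]] _] z _.
  by rewrite -(mulVKf f0 z); exact: setprod_mul.
(* Otherwise a maximal conductor exists and both dimensions are 1; the overring [K], of dimension 0,
   respects the bound. *)
- have [y ymax] := exists_max_denom fracD MoriD nDx.
  have dim1 := star_dim_w subD fracD cicD MoriD ymax.
  split; rewrite dim1 ?ltry //; apply/esym/star_dimv_eq.
    move=> V /(star_valuation_overringE subD fracD cicD MoriD)[->|[z zmax ->]].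
      by rewrite krull_dim_setT lee_fin.
    by rewrite (krull_dim_dvr (localization_dvr subD fracD cicD zmax)).
  exists (localization D (denom D y)).
    exact: localization_star_valuation_overring.
  exact: krull_dim_dvr (localization_dvr subD fracD cicD ymax).
Qed.
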